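(* For each $n\in\mathbb{N}$ (i.e. each integer $n\geqslant 1$), there is a finite non-commutative completely $0$-simple semigroup whose commuting graph has clique number equal to $n$.
   Context: A semigroup $S$ with a zero $0$ is completely $0$-simple if it is $0$-simple (it is not a null semigroup and its only ideals are $\{0\}$ and $S$) and it contains a primitive idempotent (an idempotent that is minimal among the non-zero idempotents, in the natural partial order of idempotents). The commuting graph of a finite non-commutative semigroup $S$ is the simple graph with vertex set $S\setminus Z(S)$, where $Z(S)$ is the center of $S$, and where distinct vertices $x,y$ are adjacent iff $xy=yx$. The clique number is the largest size of a set of pairwise adjacent vertices. *)

(* Defs.v *)
From HB Require Import structures.
From mathcomp Require Import all_boot.

Set Implicit Arguments.
Unset Strict Implicit.
Unset Printing Implicit Defensive.

Local Open Scope group_scope.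

#[short(type="finSemigroupType")]
HB.structure Definition FinSemigroup := {S of Semigroup S & Finite S}.

Section SemigroupDefs.
Variable S : finSemigroupType.
Implicit Types (x y z e f s : S) (I : {set S}).

Definition is_zero z : Prop := forall x, z * x = z /\ x * z = z.

Definition null_semigroup z : Prop := forall x y, x * y = z.

(* Ideals are two-sided and non-empty. *)
Definition is_ideal I : Prop :=
  I != set0 /\ forall s x, x \in I -> s * x \in I /\ x * s \in I.

Definition zero_simple z : Prop :=
  ~ null_semigroup z /\
  forall I, is_ideal I <-> I = [set z] \/ I = [set: S].

Definition idempotent_elt e : Prop := e * e = e.

(* The natural partial order; it is meant for idempotents e and f. *)
Definition idem_le f e : Prop := e * f = f /\ f * e = f.

Definition primitive_idempotent z e : Prop :=
  [/\ idempotent_elt e, e <> z &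
      forall f, idempotent_elt f -> f <> z -> idem_le f e -> f = e].

Definition completely_zero_simple : Prop :=
  exists z, [/\ is_zero z, zero_simple z & exists e, primitive_idempotent z e].

Definition noncommutative : Prop := ~ forall x y, commute x y.

Definition semigroup_center : {set S} := [set x | [forall y, x * y == y * x]].

End SemigroupDefs.

Arguments completely_zero_simple S : clear implicits.
Arguments noncommutative S : clear implicits.
Arguments semigroup_center S : clear implicits.

Record simple_graph := SimpleGraph {
  vertex :> finType;
  adjacent : rel vertex;
  adjacent_sym : symmetric adjacent;
  adjacent_irr : irreflexive adjacent
}.

Section CliqueNumber.
Variable G : simple_graph.

Definition is_clique (K : {set G}) : bool :=
  [forall x in K, forall y in K, (x != y) ==> adjacent x y].

Definition clique_number : nat := \max_(K : {set G} | is_clique K) #|K|.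

End CliqueNumber.

Section CommutingGraph.
Variable S : finSemigroupType.

Definition noncentral : finType := {x : S | x \notin semigroup_center S}.

Definition commuting_adj : rel noncentral :=
  fun x y => (x != y) && (val x * val y == val y * val x).

Lemma commuting_adj_sym : symmetric commuting_adj.
Proof. by move=> x y; rewrite /commuting_adj eq_sym [X in _ && X]eq_sym. Qed.

Lemma commuting_adj_irr : irreflexive commuting_adj.
Proof. by move=> x; rewrite /commuting_adj eqxx. Qed.

Definition commuting_graph : simple_graph :=
  SimpleGraph commuting_adj_sym commuting_adj_irr.

End CommutingGraph.

(* Main.v *)
(** Take a finite abelian group [G] of order [n], form its direct product with
    the two-element right zero band, and adjoin a zero.  The result is a Rees
    matrix semigroup over [G], so it is completely 0-simple.  Its center is [0],
    and two non-zero elements commute exactly when their band components agree,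
    so the maximal cliques are the two copies of [G]. *)
From HB Require Import structures.
Require Import Defs.
From mathcomp Require Import all_boot.
From mathcomp Require Import fingroup zmodp.

Set Implicit Arguments.
Unset Strict Implicit.
Unset Printing Implicit Defensive.

Section RightGroupWithZero.
Local Open Scope group_scope.
Variable gT : finGroupType.

Definition right_group0 : Type := option (gT * bool).

HB.instance Definition _ := Finite.on right_group0.

Definition right_group0_mul (x y : right_group0) : right_group0 :=
  match x, y with
  | Some (g, _), Some (h, c) => Some (g * h, c)
  | _, _ => None
  end.

Lemma right_group0_mulA : associative right_group0_mul.
Proof. by move=> [[g b]|] [[h c]|] [[k d]|] //=; rewrite mulgA. Qed.

HB.instance Definition _ := hasMul.Build right_group0 right_group0_mul.
HB.instance Definition _ :=
  Magma_isSemigroup.Build right_group0 right_group0_mulA.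

Let S : finSemigroupType := right_group0.
Let zero : S := None.
Let elt (g : gT) (b : bool) : S := Some (g, b).

Lemma right_group0_mulE g b h c : elt g b * elt h c = elt (g * h) c.
Proof. by []. Qed.

Lemma right_group0_noncommutative : noncommutative S.
Proof. by move=> /(_ (elt 1 true) (elt 1 false)) []. Qed.

Lemma right_group0_is_zero : is_zero zero.
Proof. by move=> [[g b]|]. Qed.

(** Right multiplication alone carries any non-zero element to every other one, so an ideal
    containing a non-zero element is everything. *)
Lemma right_group0_zero_simple : zero_simple zero.
Proof.
split=> [/(_ (elt 1 true) (elt 1 true)) //|I]; split; last first.
  case=> ->; split; try by apply/set0Pn; exists zero; rewrite inE.
    by move=> s x /set1P ->; case: (right_group0_is_zero s) => -> ->; rewrite inE.
  by move=> s x; rewrite !inE.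
case=> /set0Pn[x0 Ix0] idI.
have Iz : zero \in I.
  by have [+ _] := idI zero _ Ix0; case: (right_group0_is_zero x0) => ->.
case: (pickP [pred x in I | x != zero]) => [x /andP[Ix nzx]|Iz_only]; last first.
  left; apply/setP=> x; rewrite inE; apply/idP/eqP => [Ix|-> //].
  by apply/eqP; move: (Iz_only x); rewrite /= Ix /=; case: eqP.
right; apply/setP=> -[[h c]|]; rewrite inE //.
case: x Ix nzx => [[g b]|] // Ix _.
(* Solving [(g, b) * (k, c) = (h, c)] in the group gives [k = g^-1 * h]; the component [b] is
   overwritten by [c]. *)
have [_] := idI (elt (g^-1 * h) c) _ Ix.
by rewrite right_group0_mulE mulKVg.
Qed.

(** Cancelling [g] in [g * g = g] leaves the identity as the only possible group component. *)
Lemma right_group0_idempotent (f : S) :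
  idempotent_elt f -> f <> zero -> exists b, f = elt 1 b.
Proof.
case: f => [[g b]|] // [gg _]; exists b.
by rewrite -[g in LHS](mulKg g) gg mulVg.
Qed.

Lemma right_group0_completely_zero_simple : completely_zero_simple S.
Proof.
exists zero; split; [exact: right_group0_is_zero|exact: right_group0_zero_simple|].
exists (elt 1 true); split=> // [|f].
  by rewrite /idempotent_elt right_group0_mulE mulg1.
move=> idf nzf; have [b ->] := right_group0_idempotent idf nzf.
(* A product keeps its right factor's band component, so [e * f = f] holds for either [b]; it is
   [f * e = f] that forces [b = true]. *)
by case=> _; rewrite right_group0_mulE mulg1.
Qed.

Lemma right_group0_center : semigroup_center S = [set zero].
Proof.
apply/setP=> x; rewrite !inE; apply/forallP/eqP => [cx|-> y].
  (* Flipping the band component gives an element whose two products with [x] end in different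
     booleans. *)
  case: x cx => [[g b]|] // /(_ (elt 1 (~~ b))) /eqP [_].
  by case: b.
by case: (right_group0_is_zero y) => -> ->.
Qed.

Hypothesis cGG : abelian [set: gT].

(** Since the group is abelian, the two products can differ only in their last components, [c] and
    [b]. *)
Lemma right_group0_commuteE g b h c :
  (elt g b * elt h c == elt h c * elt g b) = (b == c).
Proof.
rewrite !right_group0_mulE (centsP cGG g (in_setT g) h (in_setT h)).
by apply/eqP/eqP => [[]|->].
Qed.

Lemma right_group0_clique_number :
  clique_number (commuting_graph S) = #|gT|.
Proof.
have nc g b : elt g b \notin semigroup_center S by rewrite right_group0_center inE.
pose v g b : commuting_graph S := exist _ (elt g b) (nc g b).
have vP x : exists g b, x = v g b.
  case: x => -[[g b]|] ncx; first by exists g, b; apply: val_inj.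
  by case/negP: (ncx); rewrite right_group0_center inE.
have v_inj b : injective (v^~ b) by move=> g h [].
have adjE g b h c : adjacent (v g b) (v h c) = (v g b != v h c) && (b == c).
  by rewrite /= /commuting_adj /= right_group0_commuteE.
apply/eqP; rewrite eqn_leq; apply/andP; split.
  (* Upper bound: any member [x0] of a clique fixes the band component [b0] of all the others, so
     the clique lies in one copy of the group. *)
  apply/bigmax_leqP => K cK.
  have [->|[x0 Kx0]] := set_0Vmem K; first by rewrite cards0.
  have [g0 [b0 def_x0]] := vP x0.
  rewrite -cardsT -(card_imset _ (v_inj b0)); apply/subset_leq_card/subsetP => x Kx.
  have [g [b def_x]] := vP x.
  suff -> : x = v g b0 by apply: imset_f.
  move/forall_inP: cK => /(_ x0 Kx0)/forall_inP/(_ x Kx)/implyP.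
  rewrite def_x0 def_x adjE; case: eqP => [[_ ->] //|_ /(_ isT)/= /eqP -> //].
(* Lower bound: the copy with band component [true] is itself a clique. *)
rewrite -cardsT -(card_imset _ (v_inj true)).
apply: (@leq_bigmax_cond _ _ (fun K : {set commuting_graph S} => #|K|)).
apply/forall_inP=> _ /imsetP[g _ ->]; apply/forall_inP=> _ /imsetP[h _ ->].
by apply/implyP; rewrite adjE eqxx andbT.
Qed.

End RightGroupWithZero.

Theorem corollary9p4 (n : nat) (hn : (1 <= n)%N) :
  exists S : finSemigroupType,
    [/\ noncommutative S,
        completely_zero_simple S &
        clique_number (commuting_graph S) = n].
Proof.
(* After the case split [n] is the predecessor, so the cyclic group ['I_n.+1] has exactly the
   required order. *)
case: n hn => // n _; exists (right_group0 'I_n.+1); split.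
- exact: right_group0_noncommutative.
- exact: right_group0_completely_zero_simple.
by rewrite right_group0_clique_number ?card_ord //; apply: Zp_abelian.
Qed.
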